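(* Let $\alpha$ be a real number with $\alpha-\max G\neq 0,-1,-2,\ldots$. Then for any nonzero polynomial $p\in\mathbb{R}[x]$, putting $s=\deg p+\max G+1$, there exist real numbers $\gamma_{n,j}$ ($n\ge 0$, $-s\le j\le s$) with $\gamma_{n,s}\neq 0$ and $\gamma_{n,-s}\neq 0$ such that the sequence $(q_n)_n$ satisfies the recurrence relation $$x^{\max G+1}p(x)\,q_n(x)=\sum_{j=-s}^{s}\gamma_{n,j}\,q_{n+j}(x),\qquad n\ge 0 .$$
   Context: For $\alpha\in\mathbb{R}$ the Laguerre polynomials are $L_n^{\alpha}(x)=\sum_{j=0}^n\frac{(-x)^j}{j!}\binom{n+\alpha}{n-j}$ for $n\ge 0$, and $L_n^\alpha=0$ for $n<0$ (here $\binom{y}{k}=y(y-1)\cdots(y-k+1)/k!$). $G=\{g_1<g_2<\cdots<g_m\}$ is a finite set of $m\ge 1$ positive integers and, for each $g\in G$, $\mathcal{R}_g$ is a real polynomial of degree $g$ with leading coefficient $1/g!$. Put $\Omega_G(x)=\det\left(\mathcal{R}_{g_l}(x-j)\right)_{l,j=1}^m$. Standing assumption: $\Omega_G(n)\neq 0$ for $n=0,1,2,\ldots$. The polynomials $(q_n)_{n\ge 0}$ are defined by $$q_n(x)=\begin{vmatrix} L^\alpha_n(x) & L^\alpha_{n-1}(x) & \cdots & L^\alpha_{n-m}(x)\\ \mathcal{R}_{g_1}(n)&\mathcal{R}_{g_1}(n-1)&\cdots&\mathcal{R}_{g_1}(n-m)\\ \vdots&\vdots&\ddots&\vdots\\ \mathcal{R}_{g_m}(n)&\mathcal{R}_{g_m}(n-1)&\cdots&\mathcal{R}_{g_m}(n-m)\end{vmatrix},$$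 so $\deg q_n=n$. Convention: $q_k=0$ for $k<0$ (so that coefficients $\gamma_{n,j}$ with $n+j<0$ are immaterial). *)

(* Defs.v *)
From mathcomp Require Import all_boot all_order all_algebra.
From mathcomp Require Import reals.

Set Implicit Arguments.
Unset Strict Implicit.
Unset Printing Implicit Defensive.

Import Order.TTheory GRing.Theory Num.Theory.
Local Open Scope ring_scope.

Definition gbinom (R : realType) (y : R) (k : nat) : R :=
  (\prod_(i < k) (y - i%:R)) / k`!%:R.

Definition laguerre_nat (R : realType) (a : R) (n : nat) : {poly R} :=
  \sum_(j < n.+1) (gbinom (n%:R + a) (n - j) / j`!%:R) *: (- 'X) ^+ j.

Definition laguerre (R : realType) (a : R) (n : int) : {poly R} :=
  if n is Posz k then laguerre_nat a k else 0.

(* A finite set of naturals is given by its increasing enumeration [G], so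
   that [nth 0 G l] is the (l+1)-st smallest element. *)

Definition maxG (G : seq nat) : nat := \max_(g <- G) g.

(* The column index [j : 'I_m] starts at 0, whence the shift by [j.+1]. *)
Definition Omega (R : realType) (G : seq nat) (calR : nat -> {poly R}) (x : R)
    : R :=
  \det (\matrix_(l < size G, j < size G) (calR (nth 0%N G l)).[x - j.+1%:R]).

(* For [n < 0] the first row vanishes, hence so does [q G calR a n]. *)
Definition q (R : realType) (G : seq nat) (calR : nat -> {poly R}) (a : R)
    (n : int) : {poly R} :=
  \det (col_mx
    (\row_(j < 1 + size G) laguerre a (n - j%:Z))
    (\matrix_(l < size G, j < 1 + size G)
       ((calR (nth 0%N G l)).[(n - j%:Z)%:~R])%:P)).

(* Main.v *)
Require Import Defs.
From mathcomp Require Import all_boot all_order all_algebra.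
From mathcomp Require Import reals.
From mathcomp Require boolp.
From mathcomp Require Import ring zify.

(** The recurrence is read off in the space V of finite formal combinations of
    symbols e_k, k in Z, standing for the Laguerre polynomials L_k. The
    three-term recurrence makes multiplication by x an operator T on V ([xmul]),
    and substituting L_k for e_k, with L_k = 0 for k < 0, turns T into honest
    multiplication by x ([xmul_adj_laguerre], [pairing_poly_act_laguerre]).
    Expanding the determinant along its first row lifts q_n to an element of V
    supported in [n - m, n], with extreme coefficients Omega(n) and, up to sign,
    Omega(n + 1), both nonzero for n >= 0.

    A polynomial sequence P defines the linear form sending e_k to P(k) on V.
    The transpose of T maps polynomial sequences to polynomial sequences and
    lowers their degree ([size_xmul_adj_poly]): it consists of first differences
    and of k times a second difference. Hence the forms given by the R_g, of
    degree at most max G, vanish on T^(max G + 1) V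
    ([pairing_poly_act_polyval]). They also vanish on the formal q_n, because a
    determinant with two equal rows is zero ([casorati_polyval]).

    Therefore c = T^(max G + 1) p(T) q_n is supported in [n - m - s, n + s] and
    killed by the R_g. Subtracting multiples of the formal q_k, from k = n + s
    down to k = max(n - s, 0), leaves a remainder with support below
    max(n - s, 0) ([qcoef_peel]). For n >= s this remainder lives on m
    consecutive indices and is killed by the m forms R_g, whose matrix there has
    determinant Omega(n - s), up to a permutation of the columns: it is zero
    ([killed_window]). For n < s it lives on negative indices and disappears on
    passing to polynomials. The coefficients of q_(n+s) and of q_(n-s) are
    nonzero because the extreme coefficients of c are; at the bottom they are
    products of factors k + alpha, controlled by the hypothesis on alpha. *)

Set Implicit Arguments.
Unset Strict Implicit.
Unset Printing Implicit Defensive.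

Import Order.TTheory GRing.Theory Num.Theory.
Local Open Scope ring_scope.

(** * The three-term recurrence of the Laguerre polynomials *)

Section Laguerre.
Variable (R : realType).
Implicit Types (y a : R) (k n : nat).

Lemma natS_neq0 k : k%:R + 1 != 0 :> R.
Proof. by rewrite natr1 pnatr_eq0. Qed.

Lemma fact_neq0 k : k`!%:R != 0 :> R.
Proof. by rewrite pnatr_eq0 -lt0n fact_gt0. Qed.

Lemma gbinom0 y : gbinom y 0 = 1.
Proof. by rewrite /gbinom big_ord0 fact0 divr1. Qed.

Lemma gbinom_top y k : (k%:R + 1) * gbinom y k.+1 = (y - k%:R) * gbinom y k.
Proof.
rewrite /gbinom big_ord_recr /= factS natrM.
have h1 := natS_neq0 k; have h2 := fact_neq0 k.
by field; rewrite h2 addrC h1.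
Qed.

Lemma gbinom_absorb y k :
  (k%:R + 1) * gbinom (y + 1) k.+1 = (y + 1) * gbinom y k.
Proof.
rewrite /gbinom big_ord_recl /= factS natrM subr0.
have -> : \prod_(i < k) (y + 1 - (bump 0 i)%:R) = \prod_(i < k) (y - i%:R).
  by apply: eq_bigr => i _; rewrite /bump /= natrD; ring.
have h1 := natS_neq0 k; have h2 := fact_neq0 k.
by field; rewrite h2 addrC h1.
Qed.

Lemma gbinom_pascal y k : gbinom (y + 1) k.+1 = gbinom y k.+1 + gbinom y k.
Proof.
apply: (mulfI (natS_neq0 k)).
rewrite gbinom_absorb mulrDr gbinom_top; ring.
Qed.

Lemma coef_laguerre_nat a n j :
  (laguerre_nat a n)`_j =
  if (j <= n)%N then (-1) ^+ j * (gbinom (n%:R + a) (n - j) / j`!%:R) else 0.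
Proof.
have -> : laguerre_nat a n =
    \poly_(i < n.+1) ((-1) ^+ i * (gbinom (n%:R + a) (n - i) / i`!%:R)).
  rewrite poly_def; apply: eq_bigr => i _.
  by rewrite -scaleN1r exprZn scalerA mulrC.
by rewrite coef_poly ltnS.
Qed.

(** The transpose of [xmul] below. It is the right-hand side of the three-term
    recurrence of the Laguerre polynomials, read at every integer index. *)
Definition xmul_adj (a : R) (F : int -> {poly R}) (k : int) : {poly R} :=
  (k%:~R *+ 2 + a + 1) *: F k - (k%:~R + 1) *: F (k + 1)
  - (k%:~R + a) *: F (k - 1).

(** The three-term recurrence, valid on all of Z with the convention that
    L_n = 0 for n < 0: at n = -1 the coefficient n + 1 of L_0 vanishes, which
    is why truncating at 0 is compatible with the formal recurrence. For n >= 0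
    the coefficients of x^j are compared; writing G for the binomials of
    argument n + a, the absorption identity and Pascal's rule express all three
    binomials through G_(n-j) and G_(n-j+1), and the recursion between these
    two leaves - j G_(n-j+1). *)
Lemma xmul_adj_laguerre a (k : int) :
  xmul_adj a (laguerre a) k = 'X * laguerre a k.
Proof.
case: k => [n|n]; last first.
  rewrite /xmul_adj [Negz n - 1](_ : _ = Negz n.+1); last by lia.
  case: n => [|n].
    rewrite (_ : (Negz 0)%:~R + 1 = 0) /= ?addNr //.
    by rewrite !(scaler0, scale0r, mulr0, subr0).
  rewrite [Negz n.+1 + 1](_ : _ = Negz n); last by lia.
  by rewrite /= !(scaler0, mulr0, subr0).
have prevE j : (laguerre a (n%:Z - 1))`_j =
    if (j < n)%N then (-1) ^+ j * (gbinom (n%:R - 1 + a) (n - j.+1) / j`!%:R)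
    else 0.
  case: n => [|n]; first by rewrite coef0.
  rewrite (_ : n.+1%:Z - 1 = n) /=; last by lia.
  by rewrite coef_laguerre_nat ltnS -natr1 addrK subSS.
rewrite /xmul_adj; apply/polyP => j.
rewrite !(coefB, coefZ) prevE [n%:Z + 1](_ : _ = n.+1%:Z) /=; last by lia.
rewrite coefXM !coef_laguerre_nat -pmulrn.
(* Brings the coefficient of x^j in x L_n over j!, as in the other terms. *)
have shiftE (i : nat) (z : R) :
    (if i == 0%N then 0 else (-1) ^+ i.-1 * (z / (i.-1)`!%:R)) =
    (-1) ^+ i * (- i%:R * (z / i`!%:R)).
  case: i => [|i] /=; first by rewrite oppr0 mul0r mulr0.
  rewrite factS natrM exprS; have h1 := natS_neq0 i; have h2 := fact_neq0 i.
  by rewrite -natr1; field; rewrite h2 h1.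
have [jn|nj|->] := ltngtP j n.
- have [i en] : exists i, n = (j + i.+1)%N by exists (n - j).-1; lia.
  rewrite (_ : (j <= n.+1)%N) 1?(_ : (j.-1 <= n)%N); [|lia|lia].
  rewrite [(n.+1 - j)%N](_ : _ = i.+2); last by lia.
  rewrite [(n - j)%N](_ : _ = i.+1); last by lia.
  rewrite [(n - j.+1)%N](_ : _ = i); last by lia.
  have -> : (if j == 0%N then 0
      else (-1) ^+ j.-1 * (gbinom (n%:R + a) (n - j.-1) / (j.-1)`!%:R)) =
    (if j == 0%N then 0
      else (-1) ^+ j.-1 * (gbinom (n%:R + a) i.+2 / (j.-1)`!%:R)).
    by case: eqP => // j0; rewrite (_ : (n - j.-1)%N = i.+2)//; lia.
  rewrite shiftE.
  have nE : n%:R = j%:R + i%:R + 1 :> R by rewrite en natrD -natr1 addrA.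
  set y := n%:R - 1 + a.
  have -> : n%:R + a = y + 1 by rewrite /y; ring.
  have -> : n.+1%:R + a = y + 1 + 1 by rewrite /y -natr1; ring.
  have absC := gbinom_absorb y i.
  have topD := gbinom_top (y + 1) i.+1.
  rewrite [gbinom (y + 1 + 1) _]gbinom_pascal.
  set A := gbinom (y + 1) i.+1 in absC topD *.
  set D := gbinom (y + 1) i.+2 in topD *.
  set C := gbinom y i in absC *.
  have key : (n%:R *+ 2 + a + 1) * A - (n%:R + 1) * (D + A) - (y + 1) * C =
      - j%:R * D.
    rewrite -absC.
    have : (y + 1 - i.+1%:R) * A = (i.+1%:R + 1) * D by [].
    move/eqP; rewrite -subr_eq0 => /eqP e; apply/eqP; rewrite -subr_eq0 -e.
    by apply/eqP; rewrite /y nE -natr1; ring.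
  rewrite [RHS](_ : _ = (-1) ^+ j * (- j%:R * D / j`!%:R)); last by ring.
  rewrite -key; ring.
- have [->|jSn] := eqVneq j n.+1.
    rewrite leqnn /= subnn subnn leqnn !gbinom0.
    rewrite factS natrM; have h1 := natS_neq0 n; have h2 := fact_neq0 n.
    by rewrite exprS -natr1; field; rewrite h2 h1.
  rewrite (_ : (j <= n.+1)%N = false) 1?(_ : (j.-1 <= n)%N = false); [|lia|lia].
  by rewrite !mulr0 !subr0 if_same.
- rewrite leqnSn subSnn subnn.
  have -> : (n.-1 <= n)%N by lia.
  rewrite [LHS](_ : _ = (-1) ^+ n * (- n%:R * (gbinom (n%:R + a) 1 / n`!%:R))).
    rewrite -shiftE; by case: (n) => // i /=; rewrite subSnn.
  have := gbinom_top (n%:R + a) 0; rewrite mulr0n add0r mul1r subr0 => ->.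
  have := gbinom_top (n.+1%:R + a) 0; rewrite mulr0n add0r mul1r subr0 => ->.
  rewrite !gbinom0 -natr1; ring.
Qed.
End Laguerre.

(** * Multiplication by x on formal two-sided Laguerre series *)

Section Formal.
Variable (R : realType).
Implicit Types (a : R) (c d : int -> R) (F : int -> {poly R}).

(** A finite difference lowers the degree: the leading terms cancel. *)
Lemma size_shift_sub (P : {poly R}) (e : R) :
  (size (P \Po ('X + e%:P) - P)%R <= (size P).-1)%N.
Proof.
elim/poly_ind: P => [|P x IH]; first by rewrite comp_poly0 subr0 size_poly0.
have -> : (P * 'X + x%:P) \Po ('X + e%:P) - (P * 'X + x%:P) =
    (P \Po ('X + e%:P) - P) * ('X + e%:P) + e *: P.
  rewrite comp_polyD comp_polyM comp_polyX comp_polyC -mul_polyC; ring.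
have [->|P0] := eqVneq P 0.
  by rewrite comp_poly0 subr0 mul0r scaler0 addr0 size_poly0.
rewrite size_MXaddC (negbTE P0) /=.
have sP : (0 < size P)%N by rewrite size_poly_gt0.
rewrite (leq_trans (size_polyD _ _)) // geq_max.
rewrite (leq_trans (size_scale_leq _ _)) // andbT.
rewrite (leq_trans (size_polyMleq _ _)) //.
rewrite size_XaddC addn2 /= (leq_trans (_ : _ <= (size P).-1.+1)%N) //.
by rewrite prednK.
Qed.

(** Constant polynomials rather than scalars, so that polynomial sequences and
    Laguerre polynomials can be substituted for the same formal basis. *)
Definition polyval (P : {poly R}) (k : int) : {poly R} := (P.[k%:~R])%:P.

(** [b] is the backward difference of [P] up to sign, so this is a second
    difference multiplied by the variable plus first differences: the terms of
    degree [deg P] in the three-term operator cancel. *)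
Definition xmul_adj_poly a (P : {poly R}) : {poly R} :=
  let b := P \Po ('X + (-1)%:P) - P in
  'X * (b \Po ('X + 1%:P) - b) - (P \Po ('X + 1%:P) - P) - a *: b.

Lemma xmul_adj_polyval a P :
  xmul_adj a (polyval P) =1 polyval (xmul_adj_poly a P).
Proof.
move=> k; rewrite /xmul_adj /polyval /xmul_adj_poly.
rewrite -!mul_polyC -!polyCM -!polyCB.
congr polyC.
rewrite !(hornerE, horner_comp) rmorphB rmorphD /= addrK; ring.
Qed.

Lemma size_xmul_adj_poly a P : (size (xmul_adj_poly a P) <= (size P).-1)%N.
Proof.
rewrite /xmul_adj_poly; set b := _ - P.
have sb : (size b <= (size P).-1)%N by exact: size_shift_sub.
have sd := size_shift_sub b 1.
rewrite (leq_trans (size_polyD _ _)) // geq_max size_polyN.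
rewrite (leq_trans (size_scale_leq _ _)) // andbT.
rewrite (leq_trans (size_polyD _ _)) // geq_max size_polyN size_shift_sub andbT.
have [->|d0] := eqVneq (b \Po ('X + 1%:P) - b) 0.
  by rewrite mulr0 size_poly0.
rewrite mulrC size_mulX //.
have : (0 < size (b \Po ('X + 1%:P) - b)%R)%N by rewrite size_poly_gt0.
move: (size _) (size b) sd sb => u v sd sb u0.
by apply: leq_trans sb; lia.
Qed.

(** Elements of the formal space with basis (e_k), k in Z, are represented by
    their coefficient functions. *)
Definition supported (l h : int) c := forall k, (k < l) || (h < k) -> c k = 0.

Lemma supportedW l h l' h' c :
  l' <= l -> h <= h' -> supported l h c -> supported l' h' c.
Proof. by move=> ll hh cs k kP; apply: cs; lia. Qed.

(** Multiplication by x when e_k stands for the Laguerre polynomial L_k, without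
    truncation at k = 0. *)
Definition xmul a c (k : int) : R :=
  (k%:~R *+ 2 + a + 1) * c k - k%:~R * c (k - 1) - (k%:~R + 1 + a) * c (k + 1).

Lemma xmul_supported a l h c :
  supported l h c -> supported (l - 1) (h + 1) (xmul a c).
Proof.
by move=> cs k kP; rewrite /xmul !cs ?mulr0 ?subr0 //; lia.
Qed.

(** The substitution of F for the basis (e_k), for coefficient functions whose
    support lies in the [w] consecutive integers starting at [lo]. *)
Definition pairing (lo : int) (w : nat) c F : {poly R} :=
  \sum_(i < w) c (lo + i%:Z) *: F (lo + i%:Z).

(** Summation by parts: the difference of the two summands at k is
    H (k + 1) - H k for the discrete Wronskian H, which vanishes at both ends
    of the window. *)
Lemma pairing_xmul a lo w c F : supported (lo + 1) (lo + w%:Z - 2) c ->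
  pairing lo w (xmul a c) F = pairing lo w c (xmul_adj a F).
Proof.
move=> cs; apply/eqP; rewrite -subr_eq0 /pairing -sumrB; apply/eqP.
pose H (i : nat) := let k := lo + i%:Z in
  (k%:~R * c (k - 1)) *: F k - ((k%:~R + a) * c k) *: F (k - 1).
rewrite (eq_bigr (fun i : 'I_w => H i.+1 - H i)); last first.
  move=> i _; rewrite /H /xmul /xmul_adj; set k := lo + i%:Z.
  have -> : lo + i.+1%:Z = k + 1 by rewrite /k; lia.
  rewrite addrK rmorphD /= -!mul_polyC !rmorphB !rmorphD !rmorphM !rmorphD /=.
  rewrite !rmorphMn /= ; ring.
rewrite -(big_mkord xpredT (fun i => H i.+1 - H i)) telescope_sumr //.
rewrite /H /= !cs ?mulr0 ?scale0r ?subr0 //; lia.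
Qed.

Lemma pairing_narrow lo w l v c F : lo <= l -> l + v%:Z <= lo + w%:Z ->
  supported l (l + v%:Z - 1) c -> pairing lo w c F = pairing l v c F.
Proof.
move=> lol lvw cs.
have [u lE] : exists u : nat, l = lo + u%:Z by exists `|l - lo|%N; lia.
have [t wE] : exists t : nat, w = (u + (v + t))%N by exists (w - u - v)%N; lia.
rewrite /pairing wE big_split_ord big_split_ord /= big1 => [|i _]; last first.
  by rewrite cs ?scale0r //; have := ltn_ord i; lia.
rewrite add0r [X in _ + X]big1 => [|i _]; last by rewrite cs ?scale0r //; lia.
by rewrite addr0; apply: eq_bigr => i _; rewrite lE PoszD addrA.
Qed.

(** The action of the polynomial with coefficient sequence [s], by Horner's
    scheme for the operator [xmul]. *)
Definition poly_act a (s : seq R) c : int -> R :=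
  foldr (fun x d k => x * c k + xmul a d k) (fun=> 0) s.

Lemma poly_act_cons a x s c k :
  poly_act a (x :: s) c k = x * c k + xmul a (poly_act a s c) k.
Proof. by []. Qed.

Lemma xmul0 a k : xmul a (fun=> 0) k = 0.
Proof. by rewrite /xmul !mulr0 !subr0. Qed.

Lemma poly_act_supported a l h s c : supported l h c ->
  supported (l - (size s).-1%:Z) (h + (size s).-1%:Z) (poly_act a s c).
Proof.
move=> cs; elim: s => [|x s IH] //= k kP.
rewrite cs ?mulr0 ?add0r; last by lia.
case: s IH kP => [|y s] IH kP; first exact: xmul0.
apply: (@xmul_supported a _ _ _ IH k); move: kP => /=; lia.
Qed.

(** Only the leading coefficient of the acting polynomial reaches the top index,
    where each multiplication by x from index k to k + 1 contributes
    - (k + 1). *)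
Lemma poly_act_top_neq0 a l (h : nat) (x : R) (s : seq R) c :
  supported l h c -> c h != 0 ->
  last x s != 0 -> poly_act a (x :: s) c (h%:Z + (size s)%:Z) != 0.
Proof.
move=> cs ch; elim: s x => [|y s IH] x xs.
  by rewrite poly_act_cons xmul0 /= !addr0 mulf_neq0.
have sup := @poly_act_supported a _ _ (y :: s) _ cs.
rewrite poly_act_cons cs ?mulr0 ?add0r; last by rewrite /=; lia.
rewrite /xmul !(sup (h%:Z + _)) ?(sup (h%:Z + _ + 1)) /=; [|lia|lia].
rewrite !mulr0 sub0r subr0 oppr_eq0 mulf_neq0 //; first by rewrite intr_eq0; lia.
rewrite [h%:Z + _ - 1](_ : _ = h%:Z + (size s)%:Z); last by lia.
exact: IH.
Qed.

(** Symmetrically, each multiplication by x from index k to k - 1 contributes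
    - (k + a), so no k met on the way down may equal - a. *)
Lemma poly_act_bot_neq0 a l h (x : R) (s : seq R) c :
  supported l h c -> c l != 0 ->
  (forall i : nat, (i < size s)%N -> (l - i%:Z)%:~R + a != 0) ->
  last x s != 0 -> poly_act a (x :: s) c (l - (size s)%:Z) != 0.
Proof.
move=> cs cl; elim: s x => [|y s IH] x la xs.
  by rewrite poly_act_cons xmul0 /= subr0 addr0 mulf_neq0.
have sup := @poly_act_supported a _ _ (y :: s) _ cs.
rewrite poly_act_cons cs ?mulr0 ?add0r; last by rewrite /=; lia.
rewrite /xmul !(sup (l - _)) ?(sup (l - _ - 1)) /=; [|lia|lia].
rewrite !mulr0 subr0 sub0r oppr_eq0.
have e : l - (size s).+1%:Z + 1 = l - (size s)%:Z by lia.
rewrite e mulf_neq0 //; last by apply: IH => // i ile; apply: la => /=; lia.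
by rewrite -[X in _ + X + _]/(1%:~R) -rmorphD /= e; apply: la.
Qed.

Lemma pairing_poly_act_laguerre a lo w l h s c : supported l h c ->
  lo + (size s)%:Z <= l -> h + (size s)%:Z < lo + w%:Z ->
  pairing lo w (poly_act a s c) (laguerre a) =
    Poly s * pairing lo w c (laguerre a).
Proof.
move=> cs; elim: s => [|x s IH] lol hw.
  by rewrite mul0r /pairing big1 // => i _; rewrite scale0r.
have -> : pairing lo w (poly_act a (x :: s) c) (laguerre a) =
    x *: pairing lo w c (laguerre a) +
    pairing lo w (xmul a (poly_act a s c)) (laguerre a).
  rewrite /pairing scaler_sumr -big_split; apply: eq_bigr => i _.
  by rewrite poly_act_cons scalerDl scalerA.
rewrite pairing_xmul; last first.
  by apply: supportedW (@poly_act_supported a _ _ s _ cs); move: lol hw => /=; lia.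
have -> : pairing lo w (poly_act a s c) (xmul_adj a (laguerre a)) =
    'X * pairing lo w (poly_act a s c) (laguerre a).
  rewrite /pairing mulr_sumr; apply: eq_bigr => i _.
  by rewrite xmul_adj_laguerre scalerAr.
rewrite IH; [|by move: lol => /=; lia|by move: hw => /=; lia].
by rewrite /= cons_poly_def -mul_polyC; ring.
Qed.

(** A polynomial sequence P of degree less than k is orthogonal to every
    multiple of x^k: transposing the k multiplications by x applies to P, k
    times, an operator which lowers the degree. *)
Lemma pairing_poly_act_polyval a lo w l h k (s : seq R) c (P : {poly R}) :
  supported l h c ->
  lo + (k + size s)%:Z <= l -> h + (k + size s)%:Z < lo + w%:Z ->
  (size P <= k)%N -> pairing lo w (poly_act a (ncons k 0 s) c) (polyval P) = 0.
Proof.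
move=> cs; elim: k P => [|k IH] P lol hw sP.
  rewrite leqn0 size_poly_eq0 in sP; rewrite (eqP sP).
  by rewrite /pairing big1 // => i _; rewrite /polyval horner0 polyC0 scaler0.
have -> : pairing lo w (poly_act a (ncons k.+1 0 s) c) (polyval P) =
    pairing lo w (xmul a (poly_act a (ncons k 0 s) c)) (polyval P).
  by apply: eq_bigr => i _; rewrite poly_act_cons mul0r add0r.
rewrite pairing_xmul; last first.
  apply: supportedW (@poly_act_supported a _ _ _ _ cs); rewrite size_ncons; lia.
under [LHS]eq_bigr => i _ do rewrite xmul_adj_polyval.
apply: IH; [lia|lia|].
by rewrite (leq_trans (size_xmul_adj_poly _ _)) // -subn1 leq_subLR.
Qed.

End Formal.

(** * The formal counterparts of the polynomials q_n *)

Section Casorati.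
Variables (R : realType) (G : seq nat) (calR : nat -> {poly R}).
Local Notation m := (size G).
Local Notation Rl l := (calR (nth 0%N G l)).

(** The determinant defining q_n, with an arbitrary sequence F in the place of
    the Laguerre polynomials. *)
Definition casorati (F : int -> {poly R}) (n : int) : {poly R} :=
  \det (col_mx
    (\row_(j < 1 + m) F (n - j%:Z))
    (\matrix_(l < m, j < 1 + m) ((Rl l).[(n - j%:Z)%:~R])%:P)).

Definition casorati_cofactor (n : int) (j : 'I_(1 + m)) : R :=
  (-1) ^+ j * \det (\matrix_(l < m, i < m) (Rl l).[(n - (lift j i)%:Z)%:~R]).

Lemma casorati_expand F (n : int) :
  casorati F n = \sum_(j < 1 + m) casorati_cofactor n j *: F (n - j%:Z).
Proof.
rewrite /casorati (expand_det_row _ (lshift m ord0)).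
apply: eq_bigr => j _; rewrite col_mxEu mxE mulrC -mul_polyC; congr (_ * _).
rewrite /cofactor /casorati_cofactor rmorphM rmorphXn rmorphN1 /= add0n.
congr (_ * _).
rewrite -det_map_mx; congr (\det _); apply/matrixP => l i; rewrite !mxE.
case: splitP => k /= lk; first by have := ltn_ord k; rewrite -lk.
have kl : l = k :> nat by case: lk.
by rewrite !mxE kl.
Qed.

(** Two rows of the determinant coincide. *)
Lemma casorati_polyval (n : int) g :
  g \in G -> casorati (polyval (calR g)) n = 0.
Proof.
move=> gG; have gm : (index g G < m)%N by rewrite index_mem.
apply: (@determinant_alternate _ _ _ (lshift m ord0) (rshift 1 (Ordinal gm))).
  by rewrite -val_eqE.
by move=> j; rewrite col_mxEu col_mxEd !mxE /= nth_index.
Qed.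

(** The coefficient function of the lift of q_n to the formal space. *)
Definition qcoef (n k : int) : R :=
  \sum_(j < 1 + m) casorati_cofactor n j * (k == n - j%:Z)%:R.

Lemma qcoef_supported (n : int) : supported (n - m%:Z) n (qcoef n).
Proof.
move=> k kP; rewrite /qcoef big1 // => j _.
rewrite (_ : (k == _) = false) ?mulr0 //; have := ltn_ord j; lia.
Qed.

Lemma pairing_qcoef (lo : int) w (n : int) F :
  lo <= n - m%:Z -> n < lo + w%:Z ->
  pairing lo w (qcoef n) F = casorati F n.
Proof.
move=> lon nw; rewrite casorati_expand /pairing /qcoef.
under eq_bigr => i _ do rewrite scaler_suml.
rewrite exchange_big; apply: eq_bigr => j _ /=.
have jm := ltn_ord j.
have iw : (`|(n - j%:Z - lo)%R|%N < w)%N by lia.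
rewrite (bigD1 (Ordinal iw)) //= big1 => [|i].
  rewrite (_ : lo + _ = n - j%:Z); last by lia.
  by rewrite eqxx mulr1 addr0.
rewrite -val_eqE /= => ni.
rewrite (_ : (_ == _) = false) ?mulr0 ?scale0r //; lia.
Qed.

Lemma qcoefE (n : int) (j : 'I_(1 + m)) :
  qcoef n (n - j%:Z) = casorati_cofactor n j.
Proof.
rewrite /qcoef (bigD1 j) //= eqxx mulr1 big1 ?addr0 // => i.
rewrite -val_eqE /= => ij; rewrite (_ : (_ == _) = false) ?mulr0 //; lia.
Qed.

Lemma qcoef_top (n : int) : qcoef n n = Omega G calR n%:~R.
Proof.
have := qcoefE n (lshift m ord0); rewrite /= subr0 => ->.
rewrite /casorati_cofactor expr0 mul1r /Omega; congr (\det _).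
by apply/matrixP => l i; rewrite !mxE rmorphB.
Qed.

Lemma qcoef_bot (n : int) :
  qcoef n (n - m%:Z) = (-1) ^+ m * Omega G calR (n + 1)%:~R.
Proof.
rewrite (qcoefE n (ord_max : 'I_(1 + m))) /casorati_cofactor /Omega.
congr (_ * \det _).
apply/matrixP => l i.
rewrite !mxE /= /bump (_ : (m <= i)%N = false); last first.
  by have := ltn_ord i; lia.
have e : n + 1 - i.+1%:Z = n - i%:Z by lia.
by rewrite [in RHS]pmulrn -intrB e.
Qed.

(** On m consecutive indices, orthogonality to the m sequences R_g is a square
    homogeneous linear system, whose determinant is a value of Omega. *)
Lemma killed_window (x : int) (c : int -> R) (lo : int) (w : nat) :
  Omega G calR x%:~R != 0 -> supported (x - m%:Z) (x - 1) c ->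
  lo <= x - m%:Z -> x <= lo + w%:Z ->
  (forall g, g \in G -> pairing lo w c (polyval (calR g)) = 0) ->
  forall k, c k = 0.
Proof.
move=> Ox cs lox xw killed k.
pose A := \matrix_(l < m, j < m) (Rl l).[x%:~R - j.+1%:R].
pose v := \col_(j < m) c (x - j.+1%:Z).
have Av : A *m v = 0.
  apply/matrixP => l z; rewrite !mxE.
  have := killed (nth 0%N G l) (mem_nth _ (ltn_ord l)).
  rewrite (@pairing_narrow _ lo w (x - m%:Z) m) //; last 2 first.
  - by lia.
  - by apply: supportedW cs; lia.
  rewrite /pairing (reindex_inj rev_ord_inj) /= => e; apply: polyC_inj.
  rewrite polyC0 -[RHS]e rmorph_sum; apply: eq_bigr => j _ /=.
  have -> : x - m%:Z + (m - j.+1)%N%:Z = x - j.+1%:Z.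
    by have := ltn_ord j; lia.
  by rewrite !mxE /polyval -mul_polyC -polyCM rmorphB /= mulrC.
have v0 : v = 0.
  have uA : A \in unitmx by rewrite unitmxE unitfE.
  by rewrite -(mulKmx uA v) Av mulmx0.
have [kin|kout] := boolP ((x - m%:Z <= k) && (k <= x - 1)); last first.
  by apply: cs; lia.
have km : (`|(x - k - 1)%R|%N < m)%N by lia.
have := congr1 (fun u : 'cV_m => u (Ordinal km) 0) v0; rewrite !mxE /= => <-.
by congr c; lia.
Qed.

(** The top coefficient Omega(n) of the formal q_n is invertible for n >= 0, so
    the coefficients of [c] can be removed from the top downwards to index
    [b]. *)
Lemma qcoef_peel (b t : nat) (c : int -> R) :
  (forall n : nat, Omega G calR n%:R != 0) ->
  (forall k, (b + t)%N%:Z <= k -> c k = 0) ->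
  exists delta : nat -> R, forall k, b%:Z <= k ->
    c k = \sum_(i < t) delta i * qcoef (b + i)%N k.
Proof.
move=> On; elim: t c => [|t IH] c ck.
  by exists (fun=> 0) => k bk; rewrite big_ord0 ck // addn0.
pose x := (b + t)%N; pose e := c x / Omega G calR x%:R.
have [|delta deltaE] := IH (fun k => c k - e * qcoef x k).
  move=> k; rewrite le_eqVlt => /predU1P[<-|xk].
    by rewrite qcoef_top -pmulrn /e divfK // subrr.
  rewrite ck ?(qcoef_supported) ?mulr0 ?subrr //; rewrite /x; lia.
exists (fun i => if i == t then e else delta i) => k bk.
rewrite big_ord_recr /= eqxx.
rewrite (eq_bigr (fun i : 'I_t => delta i * qcoef (b + i)%N k)) => [|i _].
  by rewrite -deltaE // subrK.
by rewrite (_ : (i == t :> nat) = false) //; have := ltn_ord i; lia.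
Qed.

End Casorati.

(** * The recurrence *)

Lemma leq_maxG (G : seq nat) g : g \in G -> (g <= maxG G)%N.
Proof. by move=> gG; apply: (@leq_bigmax_seq _ _ xpredT (fun x => x)). Qed.

Lemma size_leq_maxG (G : seq nat) :
  sorted ltn G -> (forall g, g \in G -> (0 < g)%N) -> (size G <= maxG G)%N.
Proof.
move=> Gs Gp; rewrite -(size_iota 1 (maxG G)); apply: uniq_leq_size.
  exact: sorted_uniq ltn_trans ltnn _ Gs.
by move=> g gG; rewrite mem_iota Gp //= add1n ltnS leq_maxG.
Qed.

Lemma laguerre_neg (R : realType) (a : R) (k : int) : k < 0 -> laguerre a k = 0.
Proof. by case: k. Qed.

Lemma q_neg (R : realType) (G : seq nat) (calR : nat -> {poly R}) (a : R)
    (n : int) :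
  n < 0 -> q G calR a n = 0.
Proof.
move=> n0; rewrite -[LHS]/(casorati G calR (laguerre a) n) casorati_expand.
rewrite big1 // => j _; rewrite laguerre_neg ?scaler0 //; lia.
Qed.

(** A formal element [c] supported in [n - m - s, n + s] and orthogonal to the
    R_g has an honest expansion in the q_k with max(n - s, 0) <= k <= n + s
    once L_k is substituted for e_k. After subtraction of the multiples of the
    formal q_k with k >= max(n - s, 0), a remainder [r] is left. If n >= s, it
    is supported in the m indices below n - s and still orthogonal to the R_g,
    hence zero. If n < s, it is supported in the negative indices, where the
    Laguerre polynomials vanish. Only q_(n+s) reaches the index n + s, and for
    n >= s only q_(n-s) reaches n - m - s, so the extreme coefficients of [c]
    are multiples of those of the expansion. *)
Lemma killed_expansion (R : realType) (G : seq nat) (calR : nat -> {poly R})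
    (a : R) (n s : nat) (lo : int) (w : nat) (c : int -> R) :
  let b := (n - s)%N in
  let t := (n + s + 1 - b)%N in
  (forall n : nat, Omega G calR n%:R != 0) ->
  lo < n%:Z - (size G)%:Z - s%:Z -> n%:Z + s%:Z < lo + w%:Z ->
  supported (n%:Z - (size G)%:Z - s%:Z) (n%:Z + s%:Z) c ->
  (forall g, g \in G -> pairing lo w c (polyval (calR g)) = 0) ->
  exists delta : nat -> R,
    [/\ pairing lo w c (laguerre a) =
          \sum_(i < t) delta i *: q G calR a (b + i)%N,
        c (n%:Z + s%:Z) != 0 -> delta (n + s - b)%N != 0
      & (s <= n)%N -> c (n%:Z - (size G)%:Z - s%:Z) != 0 -> delta 0%N != 0].
Proof.
move=> b t; have bE : b = (n - s)%N by [].
have tE : t = (n + s + 1 - b)%N by [].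
move: b t bE tE => b t bE tE Omega_neq0 low hiw c_supp killed.
have [m mE] : exists m, m = size G by exists (size G).
rewrite -mE in low c_supp *.
have [delta deltaE] : exists delta : nat -> R, forall k, b%:Z <= k ->
    c k = \sum_(i < t) delta i * qcoef G calR (b + i)%N k.
  by apply: qcoef_peel => // k kbt; apply: c_supp; lia.
pose r k := c k - \sum_(i < t) delta i * qcoef G calR (b + i)%N k.
have r_hi k : b%:Z <= k -> r k = 0 by move=> bk; rewrite /r deltaE // subrr.
have pairing_r F : pairing lo w r F =
    pairing lo w c F - \sum_(i < t) delta i *: casorati G calR F (b + i)%N.
  rewrite (eq_bigr (fun i : 'I_t =>
    delta i *: pairing lo w (qcoef G calR (b + i)%N) F)).
    rewrite /pairing; under [X in _ - X]eq_bigr => i _ do rewrite scaler_sumr.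
    rewrite exchange_big -sumrB; apply: eq_bigr => i _ /=.
    rewrite /r scalerBl scaler_suml; congr (_ - _).
    by apply: eq_bigr => j _; rewrite scalerA.
  move=> i _; have it := ltn_ord i.
  by rewrite pairing_qcoef // -?mE; lia.
have r0 : (s <= n)%N -> forall k, r k = 0.
  move=> sn; apply: (@killed_window R G calR b%:Z r lo w) => //; rewrite -?mE.
  - by rewrite -pmulrn.
  - move=> k kP; have [bk|kb] := leP b%:Z k; first exact: r_hi.
    rewrite /r c_supp; last by lia.
    rewrite big1 ?subrr // => i _.
    by rewrite qcoef_supported ?mulr0 // -mE; lia.
  - by lia.
  - by lia.
  move=> g gG; rewrite pairing_r killed // sub0r big1 ?oppr0 // => i _.
  by rewrite casorati_polyval // scaler0.
have r_lag : pairing lo w r (laguerre a) = 0.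
  rewrite /pairing big1 // => i _; set k := lo + _.
  have [sn|ns] := leqP s n; first by rewrite r0 // scale0r.
  have [k0|k0] := ltP k 0; first by rewrite laguerre_neg // scaler0.
  by rewrite r_hi ?scale0r //; lia.
exists delta; split.
- by apply/eqP; rewrite -subr_eq0 -pairing_r r_lag.
- apply: contra_neq => d0; rewrite deltaE; last by lia.
  rewrite big1 // => i _; have it := ltn_ord i.
  have [->|ine] := eqVneq (i : nat) (n + s - b)%N; first by rewrite d0 mul0r.
  by rewrite qcoef_supported ?mulr0 //; lia.
move=> sn; apply: contra_neq => d0.
have := r0 sn (n%:Z - m%:Z - s%:Z); rewrite /r big1 ?subr0 // => i _.
have [->|i0] := eqVneq (i : nat) 0%N; first by rewrite d0 mul0r.
by rewrite qcoef_supported ?mulr0 // -mE; lia.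
Qed.

(** The formal element is x^(max G + 1) p acting on the formal q_n: it is
    orthogonal to each R_g, of degree at most max G. Its bottom coefficient
    involves the factors k + alpha with n - m - s < k <= n - m; when n >= s each
    of them is alpha + 1 - m plus a natural number, hence nonzero because
    m <= max G. *)
Lemma recurrence_at (R : realType) (G : seq nat) (calR : nat -> {poly R})
    (alpha : R)
    (G_sorted : sorted ltn G)
    (G_pos : forall g, g \in G -> (0 < g)%N)
    (calR_size : forall g, g \in G -> size (calR g) = g.+1)
    (Omega_neq0 : forall n : nat, Omega G calR n%:R != 0)
    (alpha_maxG : forall k : nat, alpha - (maxG G)%:R != - k%:R)
    (p : {poly R}) (p_neq0 : p != 0) (n : nat) :
  let s : nat := ((size p).-1 + maxG G + 1)%N in
  exists gamma : int -> R,
      [/\ gamma s%:Z != 0,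
          gamma (- s%:Z) != 0
        & 'X^((maxG G).+1) * p * q G calR alpha n%:Z =
          \sum_(k < (2 * s).+1)
            gamma (k%:Z - s%:Z) *: q G calR alpha (n%:Z + (k%:Z - s%:Z))].
Proof.
set M := maxG G; set m := size G => s.
have mM : (m <= M)%N by exact: size_leq_maxG.
have sp : (0 < size p)%N by rewrite size_poly_gt0.
have sE : (M.+1 + size p)%N = s.+1 by rewrite /s; lia.
clearbody s.
have OmegaZ (x : nat) : Omega G calR x%:Z%:~R != 0 by rewrite -pmulrn.
pose c := poly_act alpha (ncons M.+1 0 p) (qcoef G calR n).
have qs := @qcoef_supported R G calR n.
have c_supp : supported (n%:Z - m%:Z - s%:Z) (n%:Z + s%:Z) c.
  have := @poly_act_supported R alpha _ _ (ncons M.+1 0 p) _ qs.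
  by rewrite size_ncons sE.
have last_p : last 0 (ncons M 0 p) != 0.
  have -> : last 0 (ncons M 0 p) = lead_coef p; last by rewrite lead_coef_eq0.
  by rewrite lead_coefE nth_last -cat_nseq last_cat; case: (polyseq p) sp.
have size_tl : size (ncons M 0 p) = s.
  by rewrite size_ncons; apply: succn_inj; rewrite -sE.
have c_top : c (n%:Z + s%:Z) != 0.
  rewrite -size_tl; apply: poly_act_top_neq0 qs _ last_p.
  by rewrite qcoef_top.
have c_bot : (s <= n)%N -> c (n%:Z - m%:Z - s%:Z) != 0.
  move=> sn; rewrite -size_tl; apply: poly_act_bot_neq0 qs _ _ last_p.
    rewrite qcoef_bot mulf_neq0 ?signr_eq0 //.
    by rewrite (_ : n%:Z + 1 = n.+1%:Z) //; lia.
  rewrite size_tl => i is_.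
  have kE : (n - i + M - m)%N%:Z = n%:Z - m%:Z - i%:Z + M%:Z by lia.
  have := alpha_maxG (n - i + M - m)%N; apply: contra_neq => e.
  apply/eqP; rewrite subr_eq -/M pmulrn kE rmorphD /= -pmulrn.
  by rewrite opprD subrK -addr_eq0 addrC e.
(* One spare index at each end, as summation by parts requires. *)
pose lo := n%:Z - m%:Z - s%:Z - 1; pose w := (m + 2 * s + 3)%N.
have low : lo + s.+1%:Z <= n%:Z - m%:Z by rewrite /lo; lia.
have hiw : n%:Z + s.+1%:Z < lo + w%:Z by rewrite /lo /w; lia.
have killed g : g \in G -> pairing lo w c (polyval (calR g)) = 0.
  move=> gG; apply: pairing_poly_act_polyval qs _ _ _; rewrite ?sE //.
  by rewrite calR_size // ltnS leq_maxG.
have [] :=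
  @killed_expansion R G calR alpha n s lo w c Omega_neq0 _ _ c_supp killed.
- by rewrite -/m; lia.
- by lia.
set b := (n - s)%N; set t := (n + s + 1 - b)%N.
move=> delta [deltaE delta_top delta_bot].
exists (fun j => if n%:Z + j is Posz x then delta (x - b)%N else 1); split.
- exact: delta_top.
(* For n < s the index n - s is negative and the default value 1 is used. *)
- have [sn|ns] := leqP s n; last first.
    have -> : n%:Z - s%:Z = Negz (s - n).-1 by lia.
    exact: oner_neq0.
  have -> : n%:Z - s%:Z = b by rewrite /b; lia.
  by rewrite subnn; apply: delta_bot => //; apply: c_bot.
have <- : pairing lo w c (laguerre alpha) = 'X^(M.+1) * p * q G calR alpha n.
  rewrite (pairing_poly_act_laguerre _ qs) ?size_ncons ?sE //.
  rewrite pairing_qcoef; [|by rewrite -/m; lia|by lia].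
  by rewrite -polyseqMXn // polyseqK commr_polyXn.
rewrite deltaE.
have -> : (2 * s).+1 = ((s - n) + t)%N by rewrite /t /b; lia.
rewrite big_split_ord /= [X in _ = X + _]big1 ?add0r => [|i _]; last first.
  by rewrite q_neg ?scaler0 //; have := ltn_ord i; lia.
apply: eq_bigr => i _.
have -> : n%:Z + ((s - n + i)%N%:Z - s%:Z) = (b + i)%N by rewrite /b; lia.
by rewrite addKn.
Qed.

Theorem theorem4p1 (R : realType) (G : seq nat) (calR : nat -> {poly R})
    (alpha : R)
    (G_sorted : sorted ltn G)
    (G_nonempty : (1 <= size G)%N)
    (G_pos : forall g, g \in G -> (0 < g)%N)
    (calR_size : forall g, g \in G -> size (calR g) = g.+1)
    (calR_lead : forall g, g \in G -> lead_coef (calR g) = g`!%:R^-1)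
    (Omega_neq0 : forall n : nat, Omega G calR n%:R != 0)
    (alpha_maxG : forall k : nat, alpha - (maxG G)%:R != - k%:R)
    (p : {poly R}) (p_neq0 : p != 0) :
  let s : nat := ((size p).-1 + maxG G + 1)%N in
  exists gamma : nat -> int -> R,
    forall n : nat,
      [/\ gamma n s%:Z != 0,
          gamma n (- s%:Z) != 0
        & 'X^((maxG G).+1) * p * q G calR alpha n%:Z =
          \sum_(k < (2 * s).+1)
            gamma n (k%:Z - s%:Z) *: q G calR alpha (n%:Z + (k%:Z - s%:Z))].
Proof.
move=> s.
have each n :=
  recurrence_at G_sorted G_pos calR_size Omega_neq0 alpha_maxG p_neq0 n.
by have [gamma gammaP] := boolp.choice each; exists gamma.
Qed.
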